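(* If $\vdash\mathcal M:\mathsf G$, then either $\mathcal M\equiv\mathsf p\lhd\mathbf 0$ for some participant $\mathsf p$, or $\mathcal M\longrightarrow\mathcal M'$ for some multiparty session $\mathcal M'$.
   Context: Calculus. Values are natural numbers $n$, integers $i$, and $\mathsf{true},\mathsf{false}$. Expressions: $e::=x\mid v\mid \mathsf{succ}\,e\mid \mathsf{neg}\,e\mid \neg e\mid e_1\oplus e_2\mid e_1>e_2$. Evaluation $e\downarrow v$ is the least relation such that: $\mathsf{succ}\,n\downarrow n+1$ (only for naturals $n$); $\mathsf{neg}\,i\downarrow -i$; $\neg\mathsf{true}\downarrow\mathsf{false}$, $\neg\mathsf{false}\downarrow\mathsf{true}$; $v\downarrow v$; $(i_1>i_2)\downarrow\mathsf{true}$ if $i_1>i_2$, $\downarrow\mathsf{false}$ otherwise; $e_1\oplus e_2\downarrow v$ if $e_1\downarrow v$ or $e_2\downarrow v$; if $e\downarrow v$ and $\mathcal E(v)\downarrow v'$ then $\mathcal E(e)\downarrow v'$ for any one-hole expression context $\mathcal E$. Processes: $P::=\mathsf p?\ell(x).P\mid \mathsf p!\ell(e).P\mid P+P\mid \mathsf{if}\ e\ \mathsf{then}\ P\ \mathsf{else}\ P\mid \mu X.P\mid X\mid \mathbf 0$ (guarded recursion; $\mu X.P$ identified with its unfolding). Sessions: $\mathcal M::=\mathsf p\lhd P\mid\mathcal M\mid\mathcal M$; $\sum$, $\prod$ denote iterated $+$, $\mid$. Structural congruence $\equiv$: $+$ commutative and associative; $P\equiv Q\Rightarrow\mathsf p\lhd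 P\equiv\mathsf p\lhd Q$; $\mathsf p\lhd\mathbf 0\mid\mathcal M\equiv\mathcal M$; $\mid$ commutative and associative. Reduction: $\mathsf p\lhd\sum_{i\in I}\mathsf q?\ell_i(x).P_i\mid\mathsf q\lhd\mathsf p!\ell_j(e).Q\longrightarrow\mathsf p\lhd P_j\{v/x\}\mid\mathsf q\lhd Q$ if $j\in I$, $e\downarrow v$; $\mathsf p\lhd\mathsf{if}\ e\ \mathsf{then}\ P\ \mathsf{else}\ Q\longrightarrow\mathsf p\lhd P$ if $e\downarrow\mathsf{true}$, $\longrightarrow\mathsf p\lhd Q$ if $e\downarrow\mathsf{false}$; closed under contexts $C::=[\cdot]\mid C\mid\mathcal M$ and under $\equiv$. Types. Sorts $\mathtt{nat},\mathtt{int},\mathtt{bool}$ with $\leq:$ the reflexive-transitive closure of $\mathtt{nat}\leq:\mathtt{int}$. Global types $\mathsf G::=\mathsf p\to\mathsf q:\{\ell_i(S_i).\mathsf G_i\}_{i\in I}\mid\mu\mathbf t.\mathsf G\mid\mathbf t\mid\mathtt{end}$; session types $T::=\bigwedge_{i\in I}\mathsf p?\ell_i(S_i).T_i\mid\bigvee_{i\in I}\mathsf q!\ell_i(S_i).T_i\mid\mu\mathbf t.T\mid\mathbf t\mid\mathtt{end}$ (distinct labels, guarded recursion, regular-tree equality). Merge $T\sqcap T'$: $T$ if $T=T'$; $T\wedge T'$ if both are intersections of inputs from the same sender with disjoint label sets; undefined otherwise. Projection: $(\mathsf p\to\mathsf q:\{\ell_i(S_i).\mathsf G_i\}_{i\in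 I})\upharpoonright\mathsf r$ is $\bigvee_{i}\mathsf q!\ell_i(S_i).(\mathsf G_i\upharpoonright\mathsf r)$ if $\mathsf r=\mathsf p$, $\bigwedge_i\mathsf p?\ell_i(S_i).(\mathsf G_i\upharpoonright\mathsf r)$ if $\mathsf r=\mathsf q$, $\sqcap_i(\mathsf G_i\upharpoonright\mathsf r)$ (if defined) otherwise; $(\mu\mathbf t.\mathsf G)\upharpoonright\mathsf r=\mu\mathbf t.(\mathsf G\upharpoonright\mathsf r)$ if $\mathsf r$ occurs in $\mathsf G$, else $\mathtt{end}$; $\mathbf t\upharpoonright\mathsf r=\mathbf t$, $\mathtt{end}\upharpoonright\mathsf r=\mathtt{end}$. $\mathrm{pt}(\mathsf p\to\mathsf q:\{\ell_i(S_i).\mathsf G_i\})=\{\mathsf p,\mathsf q\}\cup\mathrm{pt}(\mathsf G_i)$, $\mathrm{pt}(\mu\mathbf t.\mathsf G)=\mathrm{pt}(\mathsf G)$, $\mathrm{pt}(\mathbf t)=\mathrm{pt}(\mathtt{end})=\emptyset$. Subtyping $\leqslant$: greatest relation with $\mathtt{end}\leqslant\mathtt{end}$; $\bigwedge_{i\in I\cup J}\mathsf p?\ell_i(S_i).T_i\leqslant\bigwedge_{i\in I}\mathsf p?\ell_i(S'_i).T'_i$ if $S'_i\leq:S_i$, $T_i\leqslant T'_i$ for all $i\in I$; $\bigvee_{i\in I}\mathsf p!\ell_i(S_i).T_i\leqslant\bigvee_{i\in I\cup J}\mathsf p!\ell_i(S'_i).T'_i$ if $S_i\leq:S'_i$,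 $T_i\leqslant T'_i$ for all $i\in I$. Typing: expressions: $n:\mathtt{nat}$, $i:\mathtt{int}$, booleans $:\mathtt{bool}$, $\Gamma,x:S\vdash x:S$; $\mathsf{succ}$: $\mathtt{nat}\to\mathtt{nat}$; $\mathsf{neg}$: $\mathtt{int}\to\mathtt{int}$; $\neg$: $\mathtt{bool}\to\mathtt{bool}$; $e_1\oplus e_2:S$ if both $:S$; $e_1>e_2:\mathtt{bool}$ if both $:\mathtt{int}$; subsumption via $\leq:$. Processes: if $\Gamma,x:S_i\vdash P_i:T_i$ ($i\in I$) then $\Gamma\vdash\sum_{i\in I}\mathsf q?\ell_i(x).P_i:\bigwedge_{i\in I}\mathsf q?\ell_i(S_i).T_i$; $\Gamma\vdash\mathbf 0:\mathtt{end}$; $\Gamma\vdash e:S$, $\Gamma\vdash P:T$ give $\Gamma\vdash\mathsf q!\ell(e).P:\mathsf q!\ell(S).T$; $\Gamma\vdash e:\mathtt{bool}$, $\Gamma\vdash P_1:T_1$, $\Gamma\vdash P_2:T_2$ give $\Gamma\vdash\mathsf{if}\ e\ \mathsf{then}\ P_1\ \mathsf{else}\ P_2:T_1\vee T_2$; $\Gamma,X:T\vdash P:T$ gives $\Gamma\vdash\mu X.P:T$; $\Gamma,X:T\vdash X:T$; $\Gamma\vdash P:T$ and $T\leqslant T'$ give $\Gamma\vdash P:T'$. Sessions: if $\vdash P_i:\mathsf G\upharpoonright\mathsf p_i$ for all $i\in I$ and $\mathrm{pt}(\mathsf G)\subseteq\{\mathsf p_i\}_{i\in I}$ then $\vdash\prod_{i\in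 I}\mathsf p_i\lhd P_i:\mathsf G$.
   Formalization: Global types are required to have distinct sender and receiver (p ≠ q) and nonempty branch families; with p = q the projection clauses overlap and p → p : l(nat).end would type the stuck session p ◁ p!l(1).0. *)

(* Defs.v *)
From Stdlib Require Import Permutation.
From mathcomp Require Import all_boot all_order all_algebra.

Set Implicit Arguments.
Unset Strict Implicit.
Unset Printing Implicit Defensive.

(* All binders are de Bruijn indices.  Expression variables (bound by inputs),
   process variables and type variables (bound by mu) are separate name
   spaces. *)

Definition participant := nat.
Definition label := nat.

(** * Expressions *)

(* A natural number is a nonnegative integer, so that a natural may be used
   wherever an integer is expected, in accordance with nat <=: int. *)
Inductive value := VInt of int | VBool of bool.

Inductive expr :=
| EVar of nat
| EVal of value
| ESucc of expr
| ENeg of expr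
| ENot of expr
| EPlus of expr & expr (* nondeterministic choice *)
| EGt of expr & expr.

Inductive ectx :=
| CHole
| CSucc of ectx
| CNeg of ectx
| CNot of ectx
| CPlusL of ectx & expr
| CPlusR of expr & ectx
| CGtL of ectx & expr
| CGtR of expr & ectx.

Fixpoint fill (E : ectx) (e : expr) : expr :=
  match E with
  | CHole => e
  | CSucc E => ESucc (fill E e)
  | CNeg E => ENeg (fill E e)
  | CNot E => ENot (fill E e)
  | CPlusL E e2 => EPlus (fill E e) e2
  | CPlusR e1 E => EPlus e1 (fill E e)
  | CGtL E e2 => EGt (fill E e) e2
  | CGtR e1 E => EGt e1 (fill E e)
  end.

Inductive eval : expr -> value -> Prop :=
| eval_succ (n : nat) : eval (ESucc (EVal (VInt (Posz n)))) (VInt (Posz n.+1))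
| eval_neg (i : int) : eval (ENeg (EVal (VInt i))) (VInt (- i)%R)
| eval_not (b : bool) : eval (ENot (EVal (VBool b))) (VBool (~~ b))
| eval_val (v : value) : eval (EVal v) v
| eval_gt (i j : int) :
    eval (EGt (EVal (VInt i)) (EVal (VInt j))) (VBool (j < i)%R)
| eval_plusL e1 e2 v : eval e1 v -> eval (EPlus e1 e2) v
| eval_plusR e1 e2 v : eval e2 v -> eval (EPlus e1 e2) v
| eval_ctx (E : ectx) e v v' :
    eval e v -> eval (fill E (EVal v)) v' -> eval (fill E e) v'.

(* Replacement of the expression variable k by a (closed) value. *)
Fixpoint esubst (k : nat) (v : value) (e : expr) : expr :=
  match e with
  | EVar x => if x == k then EVal v else EVar (if k < x then x.-1 else x)
  | EVal w => EVal w
  | ESucc e => ESucc (esubst k v e)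
  | ENeg e => ENeg (esubst k v e)
  | ENot e => ENot (esubst k v e)
  | EPlus e1 e2 => EPlus (esubst k v e1) (esubst k v e2)
  | EGt e1 e2 => EGt (esubst k v e1) (esubst k v e2)
  end.

Fixpoint eshift (k : nat) (e : expr) : expr :=
  match e with
  | EVar x => EVar (if k <= x then x.+1 else x)
  | EVal w => EVal w
  | ESucc e => ESucc (eshift k e)
  | ENeg e => ENeg (eshift k e)
  | ENot e => ENot (eshift k e)
  | EPlus e1 e2 => EPlus (eshift k e1) (eshift k e2)
  | EGt e1 e2 => EGt (eshift k e1) (eshift k e2)
  end.

(** * Processes *)

Inductive process :=
| PIn of participant & label & process (* binds expression variable 0 *)
| POut of participant & label & expr & process
| PSum of process & process
| PIf of expr & process & process
| PMu of process (* binds process variable 0 *)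
| PVar of nat
| PNil.

Fixpoint psubst_val (k : nat) (v : value) (P : process) : process :=
  match P with
  | PIn p l P => PIn p l (psubst_val k.+1 v P)
  | POut p l e P => POut p l (esubst k v e) (psubst_val k v P)
  | PSum P Q => PSum (psubst_val k v P) (psubst_val k v Q)
  | PIf e P Q => PIf (esubst k v e) (psubst_val k v P) (psubst_val k v Q)
  | PMu P => PMu (psubst_val k v P)
  | PVar X => PVar X
  | PNil => PNil
  end.

Fixpoint pshift_expr (k : nat) (P : process) : process :=
  match P with
  | PIn p l P => PIn p l (pshift_expr k.+1 P)
  | POut p l e P => POut p l (eshift k e) (pshift_expr k P)
  | PSum P Q => PSum (pshift_expr k P) (pshift_expr k Q)
  | PIf e P Q => PIf (eshift k e) (pshift_expr k P) (pshift_expr k Q)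
  | PMu P => PMu (pshift_expr k P)
  | PVar X => PVar X
  | PNil => PNil
  end.

Fixpoint pshift (k : nat) (P : process) : process :=
  match P with
  | PIn p l P => PIn p l (pshift k P)
  | POut p l e P => POut p l e (pshift k P)
  | PSum P Q => PSum (pshift k P) (pshift k Q)
  | PIf e P Q => PIf e (pshift k P) (pshift k Q)
  | PMu P => PMu (pshift k.+1 P)
  | PVar X => PVar (if k <= X then X.+1 else X)
  | PNil => PNil
  end.

(* Replacement of the process variable k by R. *)
Fixpoint psubst (k : nat) (R : process) (P : process) : process :=
  match P with
  | PIn p l P => PIn p l (psubst k (pshift_expr 0 R) P)
  | POut p l e P => POut p l e (psubst k R P)
  | PSum P Q => PSum (psubst k R P) (psubst k R Q)
  | PIf e P Q => PIf e (psubst k R P) (psubst k R Q)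
  | PMu P => PMu (psubst k.+1 (pshift 0 R) P)
  | PVar X => if X == k then R else PVar (if k < X then X.-1 else X)
  | PNil => PNil
  end.

(* The process variable k occurs in P outside every input/output prefix. *)
Fixpoint pexposed (k : nat) (P : process) : bool :=
  match P with
  | PIn _ _ _ | POut _ _ _ _ | PNil => false
  | PSum P Q | PIf _ P Q => pexposed k P || pexposed k Q
  | PMu P => pexposed k.+1 P
  | PVar X => X == k
  end.

Fixpoint guarded (P : process) : bool :=
  match P with
  | PIn _ _ P | POut _ _ _ P => guarded P
  | PSum P Q | PIf _ P Q => guarded P && guarded Q
  | PMu P => ~~ pexposed 0 P && guarded P
  | PVar _ | PNil => true
  end.

(* P is an iterated sum, in any bracketing, of the listed processes. *)
Fixpoint summands (P : process) : seq process :=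
  match P with
  | PSum P Q => summands P ++ summands Q
  | _ => [:: P]
  end.

Inductive pclosure (R : process -> process -> Prop) :
  process -> process -> Prop :=
| pc_base P Q : R P Q -> pclosure R P Q
| pc_refl P : pclosure R P P
| pc_sym P Q : pclosure R P Q -> pclosure R Q P
| pc_trans P Q Q' : pclosure R P Q -> pclosure R Q Q' -> pclosure R P Q'
| pc_in p l P Q : pclosure R P Q -> pclosure R (PIn p l P) (PIn p l Q)
| pc_out p l e P Q : pclosure R P Q -> pclosure R (POut p l e P) (POut p l e Q)
| pc_sum P P' Q Q' :
    pclosure R P P' -> pclosure R Q Q' -> pclosure R (PSum P Q) (PSum P' Q')
| pc_if e P P' Q Q' :
    pclosure R P P' -> pclosure R Q Q' -> pclosure R (PIf e P Q) (PIf e P' Q')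
| pc_mu P Q : pclosure R P Q -> pclosure R (PMu P) (PMu Q).

Inductive unfolds : process -> process -> Prop :=
| unfolds_mu P : guarded (PMu P) -> unfolds (PMu P) (psubst 0 (PMu P) P).

Inductive sum_law : process -> process -> Prop :=
| sum_comm P Q : sum_law (PSum P Q) (PSum Q P)
| sum_assoc P Q R : sum_law (PSum (PSum P Q) R) (PSum P (PSum Q R)).

(* The identification of recursive processes with their unfoldings. *)
Definition peq : process -> process -> Prop := pclosure unfolds.

Definition pcong : process -> process -> Prop :=
  pclosure (fun P Q => unfolds P Q \/ sum_law P Q).

(** * Sessions *)

Inductive session :=
| SProc of participant & process
| SPar of session & session.

Fixpoint components (M : session) : seq (participant * process) :=
  match M with
  | SProc p P => [:: (p, P)]
  | SPar M N => components M ++ components N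
  end.

(* Raw terms of type [session] whose processes use guarded recursion. *)
Definition is_session (M : session) : bool :=
  all (fun c => guarded c.2) (components M).

Inductive scong : session -> session -> Prop :=
| sc_refl M : scong M M
| sc_sym M N : scong M N -> scong N M
| sc_trans M N K : scong M N -> scong N K -> scong M K
| sc_par M M' N N' : scong M M' -> scong N N' -> scong (SPar M N) (SPar M' N')
| sc_proc p P Q : pcong P Q -> scong (SProc p P) (SProc p Q)
| sc_nil p M : scong (SPar (SProc p PNil) M) M
| sc_comm M N : scong (SPar M N) (SPar N M)
| sc_assoc M N K : scong (SPar (SPar M N) K) (SPar M (SPar N K)).

Inductive red : session -> session -> Prop :=
| red_comm p q (P : process) (bs : seq (label * process)) l Pj e v Q :
    summands P = [seq PIn q b.1 b.2 | b <- bs] ->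
    List.In (l, Pj) bs ->
    eval e v ->
    red (SPar (SProc p P) (SProc q (POut p l e Q)))
        (SPar (SProc p (psubst_val 0 v Pj)) (SProc q Q))
| red_then p e P Q :
    eval e (VBool true) -> red (SProc p (PIf e P Q)) (SProc p P)
| red_else p e P Q :
    eval e (VBool false) -> red (SProc p (PIf e P Q)) (SProc p Q)
| red_ctx M M' N : red M M' -> red (SPar M N) (SPar M' N)
| red_scong M M1 M1' M' :
    scong M M1 -> red M1 M1' -> scong M1' M' -> red M M'.

(** * Types *)

Inductive sort := SNat | SInt | SBool.

Inductive subsort : sort -> sort -> Prop :=
| subsort_refl S : subsort S S
| subsort_nat_int : subsort SNat SInt.

(* A family {l_i(S_i).T_i}_{i in I} is a list of triples (l, (S, T)). *)
Inductive gtype :=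
| GCom of participant & participant & seq (label * (sort * gtype))
| GMu of gtype
| GVar of nat
| GEnd.

Inductive stype :=
| TIn of participant & seq (label * (sort * stype))
| TOut of participant & seq (label * (sort * stype))
| TMu of stype
| TVar of nat
| TEnd.

Fixpoint lookup (A : Type) (l : label) (bs : seq (label * A)) : option A :=
  if bs is b :: bs then if b.1 == l then Some b.2 else lookup l bs else None.

Fixpoint gexposed (k : nat) (G : gtype) : bool :=
  match G with
  | GCom _ _ _ | GEnd => false
  | GMu G => gexposed k.+1 G
  | GVar t => t == k
  end.

(* Well-formedness, with free variables below n: nonempty families, distinct
   labels, guarded recursion and no self-communication. *)
Fixpoint wf_gtype_at (n : nat) (G : gtype) : bool :=
  match G with
  | GCom p q bs =>
      [&& p != q, ~~ nilp bs, uniq (unzip1 bs)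
        & all (fun b => wf_gtype_at n b.2.2) bs]
  | GMu G => ~~ gexposed 0 G && wf_gtype_at n.+1 G
  | GVar t => t < n
  | GEnd => true
  end.

Definition wf_gtype : gtype -> bool := wf_gtype_at 0.

Fixpoint texposed (k : nat) (T : stype) : bool :=
  match T with
  | TIn _ _ | TOut _ _ | TEnd => false
  | TMu T => texposed k.+1 T
  | TVar t => t == k
  end.

Fixpoint wf_stype_at (n : nat) (T : stype) : bool :=
  match T with
  | TIn _ bs | TOut _ bs =>
      [&& ~~ nilp bs, uniq (unzip1 bs) & all (fun b => wf_stype_at n b.2.2) bs]
  | TMu T => ~~ texposed 0 T && wf_stype_at n.+1 T
  | TVar t => t < n
  | TEnd => true
  end.

Definition wf_stype : stype -> bool := wf_stype_at 0.

Fixpoint tshift (k : nat) (T : stype) : stype :=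
  match T with
  | TIn p bs => TIn p [seq (b.1, (b.2.1, tshift k b.2.2)) | b <- bs]
  | TOut p bs => TOut p [seq (b.1, (b.2.1, tshift k b.2.2)) | b <- bs]
  | TMu T => TMu (tshift k.+1 T)
  | TVar t => TVar (if k <= t then t.+1 else t)
  | TEnd => TEnd
  end.

Fixpoint tsubst (k : nat) (U : stype) (T : stype) : stype :=
  match T with
  | TIn p bs => TIn p [seq (b.1, (b.2.1, tsubst k U b.2.2)) | b <- bs]
  | TOut p bs => TOut p [seq (b.1, (b.2.1, tsubst k U b.2.2)) | b <- bs]
  | TMu T => TMu (tsubst k.+1 (tshift 0 U) T)
  | TVar t => if t == k then U else TVar (if k < t then t.-1 else t)
  | TEnd => TEnd
  end.

(* hnf T H: H is T with its topmost mu's unfolded away, i.e. H displays the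
   root of the regular tree denoted by T. *)
Inductive hnf : stype -> stype -> Prop :=
| hnf_in p bs : hnf (TIn p bs) (TIn p bs)
| hnf_out p bs : hnf (TOut p bs) (TOut p bs)
| hnf_var t : hnf (TVar t) (TVar t)
| hnf_end : hnf TEnd TEnd
| hnf_mu T H : hnf (tsubst 0 (TMu T) T) H -> hnf (TMu T) H.

Definition same_branches (R : stype -> stype -> Prop)
    (bs cs : seq (label * (sort * stype))) : Prop :=
  forall l, match lookup l bs, lookup l cs with
            | Some (s, T), Some (s', T') => s = s' /\ R T T'
            | None, None => True
            | _, _ => False
            end.

Definition bisimulation (R : stype -> stype -> Prop) : Prop :=
  forall T U, R T U -> exists H K, [/\ hnf T H, hnf U K &
    match H, K with
    | TIn p bs, TIn q cs => p = q /\ same_branches R bs cs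
    | TOut p bs, TOut q cs => p = q /\ same_branches R bs cs
    | TVar t, TVar u => t = u
    | TEnd, TEnd => True
    | _, _ => False
    end].

(* Equality of the regular trees denoted by possibly open types; it is needed
   on open types because projection merges below mu-binders. *)
Definition tree_eq (T U : stype) : Prop := exists2 R, bisimulation R & R T U.

Definition simulation (R : stype -> stype -> Prop) : Prop :=
  forall T U, R T U -> exists H K, [/\ hnf T H, hnf U K &
    match H, K with
    | TIn p bs, TIn q cs => p = q /\
        forall l S' T', lookup l cs = Some (S', T') ->
        exists S T, [/\ lookup l bs = Some (S, T), subsort S' S & R T T']
    | TOut p bs, TOut q cs => p = q /\
        forall l S T, lookup l bs = Some (S, T) ->
        exists S' T', [/\ lookup l cs = Some (S', T'), subsort S S' & R T T']
    | TEnd, TEnd => True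
    | _, _ => False
    end].

Definition subtype (T U : stype) : Prop := exists2 R, simulation R & R T U.

Definition disjoint_labels (bs cs : seq (label * (sort * stype))) : bool :=
  ~~ has (mem (unzip1 bs)) (unzip1 cs).

(* Partial operations on types are relations whose last argument is the result,
   which is determined up to [tree_eq]. *)
Inductive merge : stype -> stype -> stype -> Prop :=
| merge_eq T T' : tree_eq T T' -> merge T T' T
| merge_in p bs bs' T T' :
    hnf T (TIn p bs) -> hnf T' (TIn p bs') -> disjoint_labels bs bs' ->
    merge T T' (TIn p (bs ++ bs')).

(* The iterated merge of a family, in any order and any bracketing. *)
Inductive bigmerge : seq stype -> stype -> Prop :=
| bigmerge_one T : bigmerge [:: T] T
| bigmerge_cat Ts Ts1 Ts2 T1 T2 T :
    Permutation Ts (Ts1 ++ Ts2) -> bigmerge Ts1 T1 -> bigmerge Ts2 T2 ->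
    merge T1 T2 T -> bigmerge Ts T.

(* T1 \/ T2, dual to [merge]: idempotent, and otherwise the union of outputs to
   the same receiver with disjoint labels. *)
Inductive union : stype -> stype -> stype -> Prop :=
| union_eq T T' : tree_eq T T' -> union T T' T
| union_out p bs bs' T T' :
    hnf T (TOut p bs) -> hnf T' (TOut p bs') -> disjoint_labels bs bs' ->
    union T T' (TOut p (bs ++ bs')).

Fixpoint pt (G : gtype) : seq participant :=
  match G with
  | GCom p q bs => p :: q :: flatten [seq pt b.2.2 | b <- bs]
  | GMu G => pt G
  | GVar _ | GEnd => [::]
  end.

Inductive proj : gtype -> participant -> stype -> Prop :=
| proj_sender p q bs cs :
    proj_branches bs p cs -> proj (GCom p q bs) p (TOut q cs)
| proj_receiver p q bs cs :
    proj_branches bs q cs -> proj (GCom p q bs) q (TIn p cs)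
| proj_other p q r bs cs T :
    r <> p -> r <> q -> proj_branches bs r cs ->
    bigmerge [seq c.2.2 | c <- cs] T -> proj (GCom p q bs) r T
| proj_mu G r T : r \in pt G -> proj G r T -> proj (GMu G) r (TMu T)
| proj_mu_end G r : r \notin pt G -> proj (GMu G) r TEnd
| proj_var t r : proj (GVar t) r (TVar t)
| proj_end r : proj GEnd r TEnd
with proj_branches : seq (label * (sort * gtype)) -> participant ->
                     seq (label * (sort * stype)) -> Prop :=
| proj_nil r : proj_branches [::] r [::]
| proj_cons l S G T bs cs r :
    proj G r T -> proj_branches bs r cs ->
    proj_branches ((l, (S, G)) :: bs) r ((l, (S, T)) :: cs).

(** * Typing *)

(* Gamma assigns sorts to expression variables, Delta assigns session types to
   process variables. *)
Inductive typed_expr (Gamma : seq sort) : expr -> sort -> Prop :=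
| te_nat (n : nat) : typed_expr Gamma (EVal (VInt (Posz n))) SNat
| te_int (i : int) : typed_expr Gamma (EVal (VInt i)) SInt
| te_bool b : typed_expr Gamma (EVal (VBool b)) SBool
| te_var x S : onth Gamma x = Some S -> typed_expr Gamma (EVar x) S
| te_succ e : typed_expr Gamma e SNat -> typed_expr Gamma (ESucc e) SNat
| te_neg e : typed_expr Gamma e SInt -> typed_expr Gamma (ENeg e) SInt
| te_not e : typed_expr Gamma e SBool -> typed_expr Gamma (ENot e) SBool
| te_plus e1 e2 S :
    typed_expr Gamma e1 S -> typed_expr Gamma e2 S ->
    typed_expr Gamma (EPlus e1 e2) S
| te_gt e1 e2 :
    typed_expr Gamma e1 SInt -> typed_expr Gamma e2 SInt ->
    typed_expr Gamma (EGt e1 e2) SBool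
| te_sub e S S' :
    typed_expr Gamma e S -> subsort S S' -> typed_expr Gamma e S'.

Inductive typed (Gamma : seq sort) (Delta : seq stype) :
  process -> stype -> Prop :=
| t_in q P (Ps : seq (label * process)) bs :
    summands P = [seq PIn q b.1 b.2 | b <- Ps] ->
    uniq (unzip1 bs) ->
    typed_branches Gamma Delta Ps bs ->
    typed Gamma Delta P (TIn q bs)
| t_nil : typed Gamma Delta PNil TEnd
| t_out q l e P S T :
    typed_expr Gamma e S -> typed Gamma Delta P T ->
    typed Gamma Delta (POut q l e P) (TOut q [:: (l, (S, T))])
| t_if e P1 P2 T1 T2 T :
    typed_expr Gamma e SBool ->
    typed Gamma Delta P1 T1 -> typed Gamma Delta P2 T2 -> union T1 T2 T ->
    typed Gamma Delta (PIf e P1 P2) T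
| t_mu P T :
    wf_stype T -> typed Gamma (T :: Delta) P T -> typed Gamma Delta (PMu P) T
| t_var X T : onth Delta X = Some T -> typed Gamma Delta (PVar X) T
| t_sub P T T' :
    wf_stype T' -> typed Gamma Delta P T -> subtype T T' ->
    typed Gamma Delta P T'
(* Judgements are about processes up to unfolding of recursion. *)
| t_eq P Q T : peq P Q -> typed Gamma Delta Q T -> typed Gamma Delta P T
with typed_branches (Gamma : seq sort) (Delta : seq stype) :
  seq (label * process) -> seq (label * (sort * stype)) -> Prop :=
| tb_nil : typed_branches Gamma Delta [::] [::]
| tb_cons l P S T Ps bs :
    typed (S :: Gamma) Delta P T -> typed_branches Gamma Delta Ps bs ->
    typed_branches Gamma Delta ((l, P) :: Ps) ((l, (S, T)) :: bs).

Inductive typed_session : session -> gtype -> Prop :=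
| ts_par M G :
    (forall p P, List.In (p, P) (components M) ->
       exists2 T, proj G p T & typed [::] [::] P T) ->
    {subset pt G <= unzip1 (components M)} ->
    typed_session M G.

(* Main.v *)
(** Only the outermost prefixes of the components matter.  The list [heads P]
    of these prefixes ignores recursion binders, and guardedness makes it
    invariant under unfolding; hence the typing derivation of a component,
    including its uses of [t_eq] and [t_sub], constrains [heads P] by the root
    of the type, and no substitution lemma is needed.  If some component starts
    with a conditional, it reduces, because closed well-typed expressions
    evaluate.  Otherwise, if the global type is [end] up to recursion, all
    components are congruent to [PNil]; and if it starts with [p -> q], then [p]
    is an output to [q] whose label the input choice of [q] offers. *)

From mathcomp Require Import all_boot all_algebra zify.
Require Import Defs.

Set Implicit Arguments.
Unset Strict Implicit.
Unset Printing Implicit Defensive.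

(** * Evaluation of closed expressions *)

(** [SNat] holds only nonnegative integers, the integers on which [eval_succ] can fire. *)
Definition has_sort (v : value) (S : sort) : Prop :=
  match S, v with
  | SNat, VInt (Posz _) | SInt, VInt _ | SBool, VBool _ => True
  | _, _ => False
  end.

(** The empty environment rules out variables. Each operand evaluates to a value of its sort, which
    an evaluation context puts in the operand's place; for a choice the left operand suffices. *)
Lemma typed_expr_eval e S :
  typed_expr [::] e S -> exists2 v, eval e v & has_sort v S.
Proof.
elim=> {e S} [n|i|b|x S|e _ [v ev sv]|e _ [v ev sv]|e _ [v ev sv]
  |e1 e2 S _ [v ev sv] _ _|e1 e2 _ [v1 ev1 sv1] _ [v2 ev2 sv2]|e S S' _ [v ev sv] sub].
- by exists (VInt (Posz n)) => //; exact: eval_val.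
- by exists (VInt i) => //; exact: eval_val.
- by exists (VBool b) => //; exact: eval_val.
- by case: x.
- case: v ev sv => // -[] // n ev _; exists (VInt (Posz n.+1)) => //.
  by apply: (eval_ctx (E := CSucc CHole) ev); exact: eval_succ.
- case: v ev sv => // i ev _; exists (VInt (- i)%R) => //.
  by apply: (eval_ctx (E := CNeg CHole) ev); exact: eval_neg.
- case: v ev sv => // b ev _; exists (VBool (~~ b)) => //.
  by apply: (eval_ctx (E := CNot CHole) ev); exact: eval_not.
- by exists v => //; exact: eval_plusL.
- case: v1 ev1 sv1 => // i ev1 _; case: v2 ev2 sv2 => // j ev2 _.
  exists (VBool (j < i)%R) => //.
  apply: (eval_ctx (E := CGtL CHole e2) ev1).
  by apply: (eval_ctx (E := CGtR (EVal (VInt i)) CHole) ev2); exact: eval_gt.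
- exists v => //; case: sub sv => // {S S'}.
  by case: v {ev}.
Qed.

(** * Guardedness and exposed variables *)

Lemma pexposed_pshift_expr j k P : pexposed j (pshift_expr k P) = pexposed j P.
Proof. by elim: P j k => //= [P IP Q IQ|_ P IP Q IQ] j k; rewrite IP IQ. Qed.

Lemma guarded_pshift_expr k P : guarded (pshift_expr k P) = guarded P.
Proof.
elim: P k => //= [P IP Q IQ|_ P IP Q IQ|P IP] k; rewrite ?IP ?IQ //.
by rewrite pexposed_pshift_expr.
Qed.

Lemma pexposed_psubst_val j k v P : pexposed j (psubst_val k v P) = pexposed j P.
Proof. by elim: P j k => //= [P IP Q IQ|_ P IP Q IQ] j k; rewrite IP IQ. Qed.

Lemma guarded_psubst_val k v P : guarded (psubst_val k v P) = guarded P.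
Proof.
elim: P k => //= [P IP Q IQ|_ P IP Q IQ|P IP] k; rewrite ?IP ?IQ //.
by rewrite pexposed_psubst_val.
Qed.

Lemma pexposed_pshift_eq k P : pexposed k (pshift k P) = false.
Proof.
elim: P k => //= [P IP Q IQ k|_ P IP Q IQ k|X k]; rewrite ?IP ?IQ //.
by case: leqP => /= h; apply/eqP; lia.
Qed.

(** [bump k] is the renumbering performed by a shift with cutoff [k], and it is injective. *)
Lemma pexposed_pshift j k P : pexposed (bump k j) (pshift k P) = pexposed j P.
Proof.
elim: P j k => //= [P IP Q IQ j k|_ P IP Q IQ j k|P IP j k|X j k];
  rewrite ?IP ?IQ //.
  by rewrite -bumpS IP.
by rewrite -[RHS](inj_eq (can_inj (bumpK k))) /bump; case: (leqP k X).
Qed.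

Lemma guarded_pshift k P : guarded (pshift k P) = guarded P.
Proof.
elim: P k => //= [P IP Q IQ k|_ P IP Q IQ k|P IP k]; rewrite ?IP ?IQ //.
by rewrite -[X in pexposed X (pshift _ _)]/(bump k.+1 0) pexposed_pshift.
Qed.

(** Substitution removes the index [k], so [j] in the result is [bump k j] in [P], unless it stems
    from a copy of [R] put at an exposed [k]. *)
Lemma pexposed_psubst j k R P :
  pexposed j (psubst k R P) =
  pexposed (bump k j) P || (pexposed k P && pexposed j R).
Proof.
elim: P j k R => //= [P IP Q IQ j k R|_ P IP Q IQ j k R|P IP j k R|X j k R].
- by rewrite IP IQ andb_orl orbACA.
- by rewrite IP IQ andb_orl orbACA.
- by rewrite IP bumpS (pexposed_pshift j 0).
- case: eqP => [->|/eqP neq] /=.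
    by rewrite (negbTE (neq_bump k j)).
  rewrite orbF -(inj_eq (can_inj (bumpK k))); congr (_ == _).
  by rewrite /bump; case: (ltnP k X) => h; case: leqP; lia.
Qed.

Lemma guarded_psubst k R P : guarded P -> guarded R -> guarded (psubst k R P).
Proof.
elim: P k R => //= [p l P IP|P IP Q IQ|e P IP Q IQ|P IP|X] k R.
- by move=> gP gR; apply: IP; rewrite ?guarded_pshift_expr.
- by move=> /andP[gP gQ] gR; rewrite IP ?IQ.
- by move=> /andP[gP gQ] gR; rewrite IP ?IQ.
- move=> /andP[nP gP] gR; rewrite IP ?guarded_pshift // andbT.
  (* The binder's own variable does not occur in the shifted [R]. *)
  by rewrite pexposed_psubst /= pexposed_pshift_eq andbF orbF.
- by case: eqP.
Qed.

(** Guardedness keeps variable 0 unexposed, so the substituted copies expose nothing new. *)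
Lemma unfolds_pexposed j P Q : unfolds P Q -> pexposed j P = pexposed j Q.
Proof.
by case=> {}P /= /andP[nP _]; rewrite pexposed_psubst (negbTE nP) orbF.
Qed.

Lemma unfolds_guarded P Q : unfolds P Q -> guarded P = guarded Q.
Proof.
by case=> {}P gP; rewrite gP guarded_psubst //; case/andP: gP.
Qed.

Lemma peq_pexposed j P Q : peq P Q -> pexposed j P = pexposed j Q.
Proof.
move=> PQ; elim: PQ j => {P Q} //=.
- by move=> P Q PQ j; exact: unfolds_pexposed.
- by move=> P Q Q' _ IP _ IQ j; rewrite IP.
- by move=> P P' Q Q' _ IP _ IQ j; rewrite IP IQ.
- by move=> _ P P' Q Q' _ IP _ IQ j; rewrite IP IQ.
Qed.

Lemma peq_guarded P Q : peq P Q -> guarded P = guarded Q.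
Proof.
elim=> {P Q} //=.
- exact: unfolds_guarded.
- by move=> P Q Q' _ -> _ ->.
- by move=> P P' Q Q' _ -> _ ->.
- by move=> _ P P' Q Q' _ -> _ ->.
- by move=> P Q PQ ->; rewrite (peq_pexposed 0 PQ).
Qed.

Lemma peq_pcong P Q : peq P Q -> pcong P Q.
Proof.
elim=> {P Q}; [|by econstructor; eauto..].
by move=> P Q PQ; apply: pc_base; left.
Qed.

(** * Heads of processes *)

(** Continuations and variable indices are left out, since unfolding can alter both. *)
Inductive head :=
| HIn of participant & label
| HOut of participant & label & expr
| HIf of expr
| HVar
| HNil.

Fixpoint heads (P : process) : seq head :=
  match P with
  | PIn p l _ => [:: HIn p l]
  | POut p l e _ => [:: HOut p l e]
  | PSum P Q => heads P ++ heads Q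
  | PIf e _ _ => [:: HIf e]
  | PMu P => heads P
  | PVar _ => [:: HVar]
  | PNil => [:: HNil]
  end.

(** An unexposed variable occurs only below prefixes or conditionals, where [heads] does not look,
    or not at all; when the latter are not entered by [pexposed] either, only prefixes remain. *)
Lemma heads_psubst k R P : ~~ pexposed k P -> heads (psubst k R P) = heads P.
Proof.
elim: P k R => //= [P IP Q IQ k R|P IP k R|X k R].
- by rewrite negb_or => /andP[nP nQ]; rewrite IP ?IQ.
- exact: IP.
- by case: eqP.
Qed.

Lemma peq_heads P Q : peq P Q -> heads P = heads Q.
Proof.
elim=> {P Q} //=.
- by move=> _ _ [P /andP[nP _]]; rewrite heads_psubst.
- by move=> P Q Q' _ -> _ ->.
- by move=> P P' Q Q' _ -> _ ->.
Qed.

(** * Removing topmost recursion and reading a process off its heads *)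

Definition is_mu (P : process) : bool := if P is PMu _ then true else false.

Lemma summands_psubst k R P :
  ~~ pexposed k P -> ~~ has is_mu (summands P) ->
  ~~ has is_mu (summands (psubst k R P)).
Proof.
elim: P => //= [P IP Q IQ|X].
  rewrite negb_or !has_cat !negb_or => /andP[nP nQ] /andP[mP mQ].
  by rewrite IP ?IQ.
by case: eqP.
Qed.

Lemma peq_expose P :
  guarded P -> exists2 Q, peq P Q & ~~ has is_mu (summands Q).
Proof.
elim: P => [p l P _|p l e P _|P IP Q IQ|e P _ Q _|P IP|X|]; last 1 first.
- by exists PNil => //; exact: pc_refl.
- by exists (PIn p l P) => //; exact: pc_refl.
- by exists (POut p l e P) => //; exact: pc_refl.
- case/andP=> /IP[P' eP mP] /IQ[Q' eQ mQ].
  by exists (PSum P' Q'); [exact: pc_sum | rewrite /= has_cat negb_or mP].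
- by exists (PIf e P Q) => //; exact: pc_refl.
- move=> gP; have /andP[nP /IP[Q eQ mQ]] := gP.
  (* The body is first exposed as [Q]. One unfolding then suffices: variable 0 is unexposed in [Q],
     so the substitution creates no summand that is a [PMu]. *)
  have eM : peq (PMu P) (PMu Q) by exact: pc_mu.
  exists (psubst 0 (PMu Q) Q).
    apply: (pc_trans eM); apply: pc_base; apply: unfolds_mu.
    by rewrite -(peq_guarded eM).
  by rewrite summands_psubst // -(peq_pexposed 0 eQ).
- by exists (PVar X) => //; exact: pc_refl.
Qed.

Lemma heads_nonempty P : 0 < size (heads P).
Proof. by elim: P => //= P IP Q IQ; rewrite size_cat addn_gt0 IP. Qed.

Lemma cat_singleton (A : Type) (s t : seq A) x :
  s ++ t = [:: x] -> 0 < size s -> 0 < size t -> False.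
Proof. by case: s => [|a [|b s]] //; case: t. Qed.

(** A sum has at least two heads, so a single head leaves only a process that is not a sum. *)
Lemma heads_singleton P h :
  ~~ has is_mu (summands P) -> heads P = [:: h] ->
  match h with
  | HIn p l => exists Q, P = PIn p l Q
  | HOut p l e => exists Q, P = POut p l e Q
  | HIf e => exists Q R, P = PIf e Q R
  | HVar => exists X, P = PVar X
  | HNil => P = PNil
  end.
Proof.
case: P => //= [p l Q|p l e Q|P Q|e P Q|X|] _; try by case=> <-; eauto.
by move=> eh; case: (cat_singleton eh (heads_nonempty _) (heads_nonempty _)).
Qed.

Lemma heads_inputs q P ls :
  ~~ has is_mu (summands P) -> heads P = [seq HIn q l | l <- ls] ->
  exists2 bs : seq (label * process),
    summands P = [seq PIn q b.1 b.2 | b <- bs] & unzip1 bs = ls.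
Proof.
elim: P ls => //= [p l P _|p l e P _|P IP Q IQ|e P _ Q _|X|] ls.
- by case: ls => [|l' []] // _ [-> ->]; exists [:: (l', P)].
- by case: ls => [|l' []].
- rewrite has_cat negb_or => /andP[mP mQ] eh.
  (* The labels are cut after as many as the left summand has heads. *)
  have eP : heads P = [seq HIn q l | l <- take (size (heads P)) ls].
    by rewrite map_take -eh take_size_cat.
  have eQ : heads Q = [seq HIn q l | l <- drop (size (heads P)) ls].
    by rewrite map_drop -eh drop_size_cat.
  have [bs -> ebs] := IP _ mP eP; have [cs -> ecs] := IQ _ mQ eQ.
  by exists (bs ++ cs); rewrite ?map_cat // /unzip1 map_cat -/unzip1 ebs ecs cat_take_drop.
- by case: ls => [|l' []].
- by case: ls => [|l' []].
- by case: ls => [|l' []].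
Qed.

(** * Typing constrains heads *)

Lemma hnf_inj T H K : hnf T H -> hnf T K -> H = K.
Proof.
move=> TH; elim: TH K => {T H}.
- by move=> p bs K TK; inversion TK.
- by move=> p bs K TK; inversion TK.
- by move=> t K TK; inversion TK.
- by move=> K TK; inversion TK.
- by move=> T H _ IH K TK; inversion TK; exact: IH.
Qed.

(** A conditional is allowed at any type, since it reduces by itself. Otherwise the labels are
    related by inclusion, not equality: this is what survives subtyping, where a supertype offers
    fewer inputs and more outputs. *)
Definition head_typed (Gamma : seq sort) (hs : seq head) (T : stype) : Prop :=
  (exists2 e, hs = [:: HIf e] & typed_expr Gamma e SBool) \/
  exists2 H, hnf T H &
  match H with
  | TIn q bs => exists2 ls, hs = [seq HIn q l | l <- ls] &
                            {subset unzip1 bs <= ls}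
  | TOut q bs => exists l e S, [/\ hs = [:: HOut q l e],
                                   typed_expr Gamma e S & l \in unzip1 bs]
  | TEnd => hs = [:: HNil]
  | _ => False
  end.

Lemma lookup_mem (A : Type) l (bs : seq (label * A)) :
  l \in unzip1 bs -> exists a, lookup l bs = Some a.
Proof.
elim: bs => //= b bs IH; rewrite in_cons eq_sym; case: eqP => [_ _|_ /IH //].
by exists b.2.
Qed.

Lemma mem_lookup (A : Type) l (bs : seq (label * A)) a :
  lookup l bs = Some a -> l \in unzip1 bs.
Proof.
elim: bs => //= b bs IH; rewrite in_cons eq_sym; case: eqP => // _ /IH ->.
Qed.

Lemma head_typed_sub Gamma hs T U :
  head_typed Gamma hs T -> subtype T U -> head_typed Gamma hs U.
Proof.
move=> [?|[H TH tH]] [R simR TU]; [by left | right].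
have [H' [K [TH' UK HK]]] := simR _ _ TU; exists K => //.
rewrite -(hnf_inj TH TH') in HK.
case: H {TH} tH HK => // [q bs|q bs|]; case: K {UK} => // r cs.
- move=> [ls -> sub] [<- cb]; exists ls => // l /lookup_mem[[S' T'] lc].
  by have [S [T0 [lb _ _]]] := cb _ _ _ lc; exact: sub (mem_lookup lb).
- move=> [l [e [S [-> te /lookup_mem[[S0 T0] lb]]]]] [<- bc].
  have [S' [T' [lc _ _]]] := bc _ _ _ lb.
  by exists l, e, S; split=> //; exact: mem_lookup lc.
Qed.

Lemma typed_branches_labels Gamma Delta Ps bs :
  typed_branches Gamma Delta Ps bs -> unzip1 Ps = unzip1 bs.
Proof. by elim=> //= *; congr (_ :: _). Qed.

Lemma heads_of_inputs q P (Ps : seq (label * process)) :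
  summands P = [seq PIn q b.1 b.2 | b <- Ps] ->
  heads P = [seq HIn q l | l <- unzip1 Ps].
Proof.
elim: P Ps => //= [p l P _|p l e P _|P IP Q IQ|e P _ Q _|P _|X|] Ps.
- by case: Ps => [|[l' P'] []] //= [-> ->].
- by case: Ps => [|? []].
- move=> es.
  rewrite (IP (take (size (summands P)) Ps)); last first.
    by rewrite map_take -es take_size_cat.
  rewrite (IQ (drop (size (summands P)) Ps)); last first.
    by rewrite map_drop -es drop_size_cat.
  by rewrite -map_cat /unzip1 -map_cat cat_take_drop.
- by case: Ps => [|? []].
- by case: Ps => [|? []].
- by case: Ps => [|? []].
- by case: Ps => [|? []].
Qed.

(** The first alternative covers process variables, whose type in [Delta] says nothing about their
    head; it is void when [Delta] is empty. *)
Lemma typed_heads Gamma Delta P T :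
  guarded P -> typed Gamma Delta P T ->
  (exists2 k, k < size Delta & pexposed k P) \/ head_typed Gamma (heads P) T.
Proof.
move=> gP tP; elim: tP gP => {Gamma Delta P T}.
- move=> Gamma Delta q P Ps bs es _ /typed_branches_labels el _; right; right.
  exists (TIn q bs); first exact: hnf_in.
  by exists (unzip1 Ps); [exact: heads_of_inputs | rewrite el].
- by move=> Gamma Delta _; right; right; exists TEnd => //; exact: hnf_end.
- move=> Gamma Delta q l e P S T te _ _ _; right; right.
  exists (TOut q [:: (l, (S, T))]); first exact: hnf_out.
  by exists l, e, S; rewrite mem_seq1.
- by move=> Gamma Delta e P1 P2 T1 T2 T te *; right; left; exists e.
(* Guardedness excludes the bound variable 0; any other exposed index drops by one outside the
   binder. *)
- move=> Gamma Delta P T _ _ IH /= /andP[nP gP].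
  have [[[|k] /= lk xk]|] := IH gP; [by rewrite xk in nP | | by right].
  by left; exists k.
- move=> Gamma Delta X T oX _; left; exists X; rewrite /= ?eqxx //.
  by rewrite -onthTE oX.
- move=> Gamma Delta P T T' _ _ IH TT' gP; have [|hP] := IH gP; first by left.
  by right; exact: head_typed_sub TT'.
- move=> Gamma Delta P Q T PQ _ IH; rewrite (peq_guarded PQ) => /IH[[k lk xk]|hQ].
    by left; exists k; rewrite ?(peq_pexposed k PQ).
  by right; rewrite (peq_heads PQ).
Qed.

(** * Projection of the root of a global type *)

(** Binders are dropped without substituting: under guarded recursion, unfolding changes only what
    lies below the root. *)
Fixpoint gstrip (G : gtype) : gtype := if G is GMu G then gstrip G else G.

Fixpoint tstrip (T : stype) : stype := if T is TMu T then tstrip T else T.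

(** A variable at the root is never bound by the stripped binders, by guardedness, so it is free;
    for [n = 0] there is none. *)
Lemma wf_gstrip n G :
  wf_gtype_at n G ->
  match gstrip G return Prop with
  | GCom p q bs => p != q
  | GMu _ => False
  | GVar _ => exists2 k, k < n & gexposed k G
  | GEnd => True
  end.
Proof.
elim: G n => //= [p q bs n /andP[]//|G IH n /andP[nG] /IH|t n lt]; last by exists t.
by case: (gstrip G) => // _ [[|k] lk xk]; [rewrite xk in nG | exists k].
Qed.

Lemma pt_gstrip G : pt (gstrip G) = pt G.
Proof. by elim: G. Qed.

Lemma proj_branches_labels bs r cs : proj_branches bs r cs -> unzip1 cs = unzip1 bs.
Proof. by elim=> //= *; congr (_ :: _). Qed.

Lemma proj_gstrip_end G r T : gstrip G = GEnd -> proj G r T -> T = TEnd.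
Proof.
case: G => //= [G|_ pG]; last by inversion pG.
move=> eG pG; inversion pG as [| | |? ? ? rG| | |] => //.
by move: rG; rewrite -pt_gstrip eG.
Qed.

Lemma proj_gstrip_sender G p q bs T :
  gstrip G = GCom p q bs -> p != q -> proj G p T ->
  exists2 cs, tstrip T = TOut q cs & unzip1 cs = unzip1 bs.
Proof.
move=> eG npq; elim: G T eG => //= [p' q' bs'|G IH] T eG pG.
  case: eG pG npq => -> -> -> pG npq.
  inversion pG as [? ? ? cs pcs| | | | | |]; subst => //.
  - by exists cs => //; exact: proj_branches_labels pcs.
  - by rewrite eqxx in npq.
(* As [p] occurs in [G], its projection keeps the binder and is not cut to [TEnd]. *)
have pp : p \in pt G by rewrite -pt_gstrip eG mem_head.
by inversion pG as [| | |? ? T' _ pT'|? ? np| |]; [exact: IH eG pT' | rewrite pp in np].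
Qed.

Lemma proj_gstrip_receiver G p q bs T :
  gstrip G = GCom p q bs -> p != q -> proj G q T ->
  exists2 cs, tstrip T = TIn p cs & unzip1 cs = unzip1 bs.
Proof.
move=> eG npq; elim: G T eG => //= [p' q' bs'|G IH] T eG pG.
  case: eG pG npq => -> -> -> pG npq.
  inversion pG as [|? ? ? cs pcs| | | | |]; subst => //.
  - by rewrite eqxx in npq.
  - by exists cs => //; exact: proj_branches_labels pcs.
have pq : q \in pt G by rewrite -pt_gstrip eG /= !in_cons eqxx orbT.
by inversion pG as [| | |? ? T' _ pT'|? ? np| |]; [exact: IH eG pT' | rewrite pq in np].
Qed.

(** * The root of a session type before and after unfolding *)

Definition same_root (T U : stype) : Prop :=
  match T, U with
  | TIn p bs, TIn q cs | TOut p bs, TOut q cs =>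
      p = q /\ unzip1 bs = unzip1 cs
  | TEnd, TEnd => True
  | _, _ => False
  end.

Fixpoint mu_depth (T : stype) : nat := if T is TMu T then (mu_depth T).+1 else 0.

Definition is_tvar (T : stype) : bool := if T is TVar _ then true else false.

Lemma tstrip_tsubst k U T :
  ~~ is_tvar (tstrip T) ->
  same_root (tstrip (tsubst k U T)) (tstrip T) /\
  mu_depth (tsubst k U T) = mu_depth T.
Proof.
elim: T k U => //= [p bs|p bs|T IH] k U nT.
- by rewrite /unzip1 -map_comp.
- by rewrite /unzip1 -map_comp.
- by have [? ->] := IH k.+1 (tshift 0 U) nT.
Qed.

Lemma same_root_trans T U V : same_root T U -> same_root U V -> same_root T V.
Proof. by case: T U V => [p bs|p bs|T|t|] [] // q cs [] // r ds /= [-> ->]. Qed.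

Lemma same_root_tvar T U : same_root T U -> ~~ is_tvar T.
Proof. by case: T U => // t []. Qed.

(** Induction on the number of leading binders: each unfolding removes one and, the root not being a
    variable, the substitution adds none. *)
Lemma tstrip_hnf T :
  ~~ is_tvar (tstrip T) -> exists2 H, hnf T H & same_root H (tstrip T).
Proof.
have [n] := ubnP (mu_depth T); elim: n T => // n IH [p bs|p bs|T|t|] //= lt nT.
- by exists (TIn p bs) => //; exact: hnf_in.
- by exists (TOut p bs) => //; exact: hnf_out.
- have [rT dT] := tstrip_tsubst 0 (TMu T) nT.
  have [|H hT rH] := IH _ _ (same_root_tvar rT); first by rewrite dT.
  by exists H; [exact: hnf_mu | exact: same_root_trans rH rT].
- by exists TEnd => //; exact: hnf_end.
Qed.

(** * Progress *)

Lemma is_session_par M N : is_session (SPar M N) = is_session M && is_session N.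
Proof. exact: all_cat. Qed.

(** Besides isolating one component, the rest keeps every other component, so that a second one can
    be extracted from it. *)
Lemma scong_extract M p P :
  List.In (p, P) (components M) ->
  exists N, [/\ scong M (SPar (SProc p P) N), is_session M -> is_session N &
    forall c, List.In c (components M) -> c = (p, P) \/ List.In c (components N)].
Proof.
elim: M => [q Q|M1 IH1 M2 IH2] /=.
  (* A lone component is padded with an inactive one, so that a rest exists. *)
  case=> // -[-> ->]; exists (SProc p PNil); split=> //.
    by apply: sc_sym; apply: sc_trans (sc_comm _ _) _; exact: sc_nil.
  by move=> c [->|//]; left.
case/(@List.in_app_or _ _ _ _) => [/IH1|/IH2] [N [eN gN cN]].
- exists (SPar N M2); split.
  + by apply: sc_trans (sc_par eN (sc_refl _)) _; exact: sc_assoc.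
  + by rewrite !is_session_par => /andP[/gN -> ->].
  + move=> c /(@List.in_app_or _ _ _ _)[/cN[->|cN']|cM];
      [by left | by right; apply: List.in_or_app; left
               | by right; apply: List.in_or_app; right].
- exists (SPar N M1); split.
  + apply: sc_trans (sc_comm _ _) _.
    by apply: sc_trans (sc_par eN (sc_refl _)) _; exact: sc_assoc.
  + by rewrite !is_session_par => /andP[-> /gN ->].
  + move=> c /(@List.in_app_or _ _ _ _)[cM|/cN[->|cN']];
      [by right; apply: List.in_or_app; right | by left
               | by right; apply: List.in_or_app; left].
Qed.

Lemma is_session_component M p P :
  is_session M -> List.In (p, P) (components M) -> guarded P.
Proof.
rewrite /is_session; elim: (components M) => //= c cs IH /andP[gc gcs] [ec|//].
  by rewrite ec in gc.
exact: IH.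
Qed.

Lemma scong_proc_peq p P Q N :
  peq P Q -> scong (SPar (SProc p P) N) (SPar (SProc p Q) N).
Proof. by move=> /peq_pcong PQ; apply: sc_par (sc_refl _); exact: sc_proc. Qed.

Lemma if_progress M p P e :
  is_session M -> List.In (p, P) (components M) ->
  heads P = [:: HIf e] -> typed_expr [::] e SBool ->
  exists M', is_session M' /\ red M M'.
Proof.
move=> gM cP hP te; have gP := is_session_component gM cP.
have [P' eP mP] := peq_expose gP.
have [|A [B eAB]] := heads_singleton mP (h := HIf e); first by rewrite -(peq_heads eP).
have [N [eN /(_ gM) gN _]] := scong_extract cP.
have := gP; rewrite (peq_guarded eP) eAB /= => /andP[gA gB].
have eM := sc_trans eN (scong_proc_peq p N eP).
have [v ev] := typed_expr_eval te; case: v ev => // b ev _.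
exists (SPar (SProc p (if b then A else B)) N); split.
  by rewrite is_session_par gN /is_session /= !andbT; case: (b).
apply: red_scong eM _ (sc_refl _); rewrite eAB; apply: red_ctx.
by case: b ev => ev; [exact: red_then | exact: red_else].
Qed.

Lemma in_unzip1 (A : Type) (l : nat) (bs : seq (nat * A)) :
  l \in unzip1 bs -> exists a, List.In (l, a) bs.
Proof.
elim: bs => //= -[l' a] bs IH; rewrite in_cons => /orP[/eqP ->|/IH[b]].
  by exists a; left.
by exists b; right.
Qed.

Lemma guarded_summand P q l Q :
  guarded P -> List.In (PIn q l Q) (summands P) -> guarded Q.
Proof.
elim: P => //= [p l' P _ gP|p l' e P _ gP|P IP R IR /andP[gP gR]|e P _ R _ _|P _ _|X _|_].
- by case=> // -[_ _ <-].
- by case.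
- by case/(@List.in_app_or _ _ _ _); [exact: IP | exact: IR].
- by case.
- by case.
- by case.
- by case.
Qed.

Lemma com_progress M p q P Q l e S ls :
  is_session M -> p != q ->
  List.In (p, P) (components M) -> List.In (q, Q) (components M) ->
  heads P = [:: HOut q l e] -> typed_expr [::] e S ->
  heads Q = [seq HIn p l | l <- ls] -> l \in ls ->
  exists M', is_session M' /\ red M M'.
Proof.
move=> gM npq cP cQ hP te hQ lls.
have gP := is_session_component gM cP; have gQ := is_session_component gM cQ.
have [P' eP mP] := peq_expose gP; have [Q' eQ mQ] := peq_expose gQ.
have [|P1 eP1] := heads_singleton mP (h := HOut q l e); first by rewrite -(peq_heads eP).
have [|bs sQ ebs] := heads_inputs (q := p) (ls := ls) mQ; first by rewrite -(peq_heads eQ).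
have [Qj lQj] : exists Qj, List.In (l, Qj) bs by apply: in_unzip1; rewrite ebs.
have gQj : guarded Qj.
  apply: (@guarded_summand Q' p l); first by rewrite -(peq_guarded eQ).
  by rewrite sQ; exact: (List.in_map (fun b => PIn p b.1 b.2) _ _ lQj).
have gP1 : guarded P1 by move: gP; rewrite (peq_guarded eP) eP1.
have [v ev _] := typed_expr_eval te.
have [N [eN /(_ gM) gN cN]] := scong_extract cQ.
(* The sender is still in the rest, since [p] differs from the extracted [q]. *)
have {cN} cP' : List.In (p, P) (components N).
  by case: (cN _ cP) => // -[epq _]; rewrite epq eqxx in npq.
have [K [eK /(_ gN) gK _]] := scong_extract cP'.
exists (SPar (SPar (SProc q (psubst_val 0 v Qj)) (SProc p P1)) K); split.
  by rewrite !is_session_par gK /is_session /= guarded_psubst_val gQj gP1.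
have eM : scong M (SPar (SPar (SProc q Q') (SProc p P')) K).
  apply: sc_trans eN _; apply: sc_trans (sc_sym (sc_assoc _ _ _)).
  apply: sc_trans (scong_proc_peq q N eQ) _; apply: sc_par (sc_refl _) _.
  by apply: sc_trans eK _; exact: scong_proc_peq.
apply: red_scong eM _ (sc_refl _); rewrite eP1; apply: red_ctx.
exact: red_comm sQ lQj ev.
Qed.

Lemma scong_all_nil M :
  (forall p P, List.In (p, P) (components M) -> pcong P PNil) ->
  exists p, scong M (SProc p PNil).
Proof.
elim: M => [p P|M1 IH1 M2 IH2] /= cM.
  by exists p; apply: sc_proc; apply: (cM p); left.
have [|p1 e1] := IH1; first by move=> p P ?; apply: (cM p); apply: List.in_or_app; left.
have [|p2 e2] := IH2; first by move=> p P ?; apply: (cM p); apply: List.in_or_app; right.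
by exists p2; apply: sc_trans (sc_par e1 e2) _; exact: sc_nil.
Qed.

(** Constructive choice between some component being a conditional and all being inactive. *)
Lemma In_or_forall (A : Type) (U V : A -> Prop) (s : seq A) :
  (forall x, List.In x s -> U x \/ V x) ->
  (exists2 x, List.In x s & U x) \/ (forall x, List.In x s -> V x).
Proof.
elim: s => [|x s IH] UV; first by right.
have [|Ux|Vx] := UV x; [by left | by left; exists x => //; left |].
case: IH => [y sy|[y sy Uy]|Vs]; first by apply: UV; right.
  by left; exists y => //; right.
by right=> y [<-|/Vs].
Qed.

Theorem mainTheorem4 (M : session) (G : gtype) :
  is_session M -> wf_gtype G ->
  typed_session M G ->
  (exists p : participant, scong M (SProc p PNil)) \/
  (exists M' : session, is_session M' /\ red M M').
Proof.
move=> gM wG tM; case: tM gM wG => {M G} M G tM sG gM wG.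
have tc p P : List.In (p, P) (components M) ->
    exists2 T, proj G p T & head_typed [::] (heads P) T.
  move=> cP; have [T pT tP] := tM p P cP; exists T => //.
  by case: (typed_heads (is_session_component gM cP) tP) => // -[].
have comp p : p \in pt G -> exists P, List.In (p, P) (components M).
  by move=> /sG /in_unzip1.
case eG: (gstrip G) (wf_gstrip wG) => [p q bs|G'|t|] //= npq; last 1 first.
(* The global type is [GEnd] under its binders: every projection is [TEnd], so each component is a
   conditional or inactive. *)
- have [] := @In_or_forall _
    (fun c => exists2 e, heads c.2 = [:: HIf e] & typed_expr [::] e SBool)
    (fun c => pcong c.2 PNil) (components M).
  + move=> [p P] cP; have [T /(proj_gstrip_end eG) -> [] hP] := tc p P cP.
      by left.
    right; case: hP => H hH; rewrite -(hnf_inj hnf_end hH) /= => hP.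
    have [P' eP mP] := peq_expose (is_session_component gM cP).
    rewrite (peq_heads eP) in hP; rewrite -(heads_singleton mP hP).
    exact: peq_pcong.
  + by move=> [[p P] cP [e hP te]]; right; exact: if_progress cP hP te.
  + by move=> nM; left; apply: scong_all_nil => p P /nM.
- have [|P cP] := comp p; first by rewrite -pt_gstrip eG mem_head.
  have [|Q cQ] := comp q; first by rewrite -pt_gstrip eG /= !in_cons eqxx orbT.
  have [T pT [[e hP te]|[H hH hP]]] := tc p P cP; first by right; exact: if_progress cP hP te.
  have [U pU [[e hQ te]|[K hK hQ]]] := tc q Q cQ; first by right; exact: if_progress cQ hQ te.
  have [cs sT ecs] := proj_gstrip_sender eG npq pT.
  have [ds sU eds] := proj_gstrip_receiver eG npq pU.
  have [|H' hH' rH] := @tstrip_hnf T; first by rewrite sT.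
  have [|K' hK' rK] := @tstrip_hnf U; first by rewrite sU.
  (* Head normal forms are unique, so the roots that type the heads are those given by
     projection. *)
  rewrite -(hnf_inj hH hH') sT in rH; rewrite -(hnf_inj hK hK') sU in rK.
  case: H {hH} hP rH => // q' cs' [l [e [S [hP te lcs]]]] [eq' ecs']; rewrite {}eq' in hP.
  case: K {hK} hQ rK => // p' ds' [ls hQ sls] [ep' eds']; rewrite {}ep' in hQ.
  (* The sent label lies in the output type, whose labels are those of the global type and hence of
     the input type, all of which the receiver offers. *)
  right; apply: com_progress gM npq cP cQ hP te hQ _; apply: sls.
  by rewrite eds' eds -ecs -ecs'.
- by case: npq.
Qed.
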